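(* For every integer $n\ge0$, the map $\pi\mapsto \mathbf{w}_n$ (defined in the context) is a bijection from the set $\mathrm{NC}_2(n)$ of $2$-distant noncrossing partitions of $[n]$ to the set $P_{12312}(n)$ of $12312$-avoiding partitions of $[n]$, where partitions in $P_{12312}(n)$ are identified with their canonical words.
   Context: Let $[n]=\{1,\dots,n\}$. A partition of $[n]$ is a collection of mutually disjoint nonempty subsets (blocks) with union $[n]$, written $(B_1,\dots,B_k)$ with $\min(B_1)<\cdots<\min(B_k)$. An edge of a partition is a pair $(i,j)$ of integers, $i<j$, in the same block such that this block contains no $t$ with $i<t<j$; we then say $j$ is connected to $i$ (and $i$ is connected to $j$). A $2$-distant noncrossing partition is a partition with no two edges $(i_1,j_1),(i_2,j_2)$ satisfying $i_1<i_2<j_1<j_2$ and $j_1-i_2\ge2$; $\mathrm{NC}_2(n)$ is the set of those of $[n]$. The canonical word of $(B_1,\dots,B_k)$ is $a_1a_2\cdots a_n$, where $a_i=j$ if $i\in B_j$. A partition is $12312$-avoiding if its canonical word contains no (not necessarily contiguous) subword order-isomorphic to $12312$; $P_{12312}(n)$ is the set of those of $[n]$. A partition in $P_{12312}(n)$ is identified with its canonical word. A marked partition is a partition in which each integer may be marked; a marked word is a word in which each letter (occurrence) may be marked. Construction of $\mathbf{w}_n$ from $\pi\in\mathrm{NC}_2(n)$. For $0\le i\le n$ let $T_i$ be the marked partition of $[i]$ obtained from $\pi$ by removing all integers greater than $i$ and marking those integers $j\le i$ that are connected in $\pi$ (by an edge) to an integer greater than $i$; so $T_0=\emptyset$ and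 $T_n=\pi$. Define marked words $\mathbf{w}_0,\dots,\mathbf{w}_n$ as follows. $\mathbf{w}_0$ is the empty word (with $\max(\mathbf{w}_0)=0$). For $1\le i\le n$, $\mathbf{w}_i$ is obtained by the following two steps (letters of $\mathbf{w}_{i-1}$ keep their marks unless stated otherwise, and the appended letter is unmarked unless marked in step (2)). (1) If $i$ is not connected to any integer in $T_i$, then $\mathbf{w}_i=\mathbf{w}_{i-1}m$ with $m=\max(\mathbf{w}_{i-1})+1$. Otherwise, $i$ is connected to either the largest or the second largest marked integer of $T_{i-1}$. - If $i$ is connected to the largest marked integer of $T_{i-1}$, let $\mathbf{w}_i=\mathbf{w}_{i-1}a_1$, where $a_1$ is the rightmost marked letter of $\mathbf{w}_{i-1}$, and then make that marked letter $a_1$ unmarked. - If $i$ is connected to the second largest marked integer of $T_{i-1}$, let $\mathbf{w}_i=\mathbf{w}_{i-1}a_2$, where $a_2$ is the second rightmost marked letter of $\mathbf{w}_{i-1}$. The second rightmost marked letter of $\mathbf{w}_{i-1}$ remains marked, but the rightmost marked letter of $\mathbf{w}_{i-1}$ is made unmarked in $\mathbf{w}_i$. (2) If $i$ is marked in $T_i$, then among the occurrences of the largest letter of $\mathbf{w}_i$, make the leftmost one marked. *)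

(* Defs.v *)
From mathcomp Require Import all_boot.

Set Implicit Arguments.
Unset Strict Implicit.
Unset Printing Implicit Defensive.

(* The ordinal i : 'I_n (0 <= i < n) stands for the integer i + 1 of [n].     *)
(* Set partitions of [n] are sets P : {set {set 'I_n}} satisfying             *)
(* partition P [set: 'I_n]. Letters of words are the positive naturals.       *)

Section Partitions.

Variable n : nat.
Implicit Types (P Q : {set {set 'I_n}}) (B : {set 'I_n}) (i j : 'I_n).

Definition is_edge P i j : bool :=
  (i < j) && [exists B in P, [&& i \in B, j \in B &
                              [forall t in B, ~~ (i < t < j)]]].

Definition connected P i j : bool := is_edge P i j || is_edge P j i.

Definition NC2 P : Prop :=
  partition P [set: 'I_n] /\
  forall i1 j1 i2 j2 : 'I_n, is_edge P i1 j1 -> is_edge P i2 j2 ->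
    ~ (i1 < i2 /\ i2 < j1 /\ j1 < j2 /\ 2 <= j1 - i2).

(* The default value n is only reached on the empty set. *)
Definition block_min B : nat := \big[minn/n]_(i in B) val i.

Definition blocks P : seq {set 'I_n} :=
  sort (fun B C => block_min B <= block_min C) (enum P).

Definition canonical_word P : seq nat :=
  [seq (index (pblock P i) (blocks P)).+1 | i <- enum 'I_n].

End Partitions.

Definition order_isomorphic (u v : seq nat) : Prop :=
  size u = size v /\
  forall a b, a < size u -> b < size u ->
    (nth 0 u a < nth 0 u b) = (nth 0 v a < nth 0 v b).

Definition contains_pattern (p w : seq nat) : Prop :=
  exists2 s, subseq s w & order_isomorphic p s.

Definition P12312 n (P : {set {set 'I_n}}) : Prop :=
  partition P [set: 'I_n] /\
  ~ contains_pattern [:: 1; 2; 3; 1; 2] (canonical_word P).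

(* A marked word is a sequence of pairs (letter, is it marked?). *)
Definition marked_word := seq (nat * bool).

Definition unmarked (w : seq nat) : marked_word := [seq (a, false) | a <- w].

Section MarkedWords.

Implicit Type w : marked_word.

Definition letter w (p : nat) : nat := (nth (0, false) w p).1.

Definition set_mark w (p : nat) (b : bool) : marked_word :=
  set_nth (0, false) w p (letter w p, b).

Definition max_letter w : nat := \max_(x <- w) x.1.

(* The positions of the marked letters, from right to left. *)
Definition marked_positions w : seq nat :=
  rev [seq p <- iota 0 (size w) | (nth (0, false) w p).2].

Definition mark_leftmost_max w : marked_word :=
  set_mark w (find (fun x => x.1 == max_letter w) w) true.

End MarkedWords.

Section Construction.

Variables (n : nat) (P : {set {set 'I_n}}).

(* The marked partition T_m, as the pair of its blocks and its marked         *)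
(* integers; an ordinal j stands for j + 1, so j < m reads "at most m".       *)
Definition T (m : nat) : {set {set 'I_n}} * {set 'I_n} :=
  ([set B :&: [set j : 'I_n | j < m] | B : {set 'I_n} in P] :\ set0,
   [set j : 'I_n | (j < m) && [exists k : 'I_n, (m <= k) && connected P j k]]).

(* The marked integers of T_m, from largest to smallest. *)
Definition marked_integers (m : nat) : seq 'I_n := rev (enum (T m).2).

(* The two steps deal with the integer i + 1 represented by i, so T i and     *)
(* T i.+1 are the T_(i-1) and T_i of the 1-based description. The result is   *)
(* None when the letter or the marks to be used do not exist.                 *)
Definition step1 (i : 'I_n) (w : marked_word) : option marked_word :=
  if ~~ [exists j, connected (T i.+1).1 i j] then
    Some (rcons w ((max_letter w).+1, false))
  else match marked_integers i, marked_positions w with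
  | j1 :: js, p1 :: ps =>
    if connected P i j1 then
      Some (rcons (set_mark w p1 false) (letter w p1, false))
    else match js, ps with
    | j2 :: _, p2 :: _ =>
      if connected P i j2 then
        Some (rcons (set_mark w p1 false) (letter w p2, false))
      else None
    | _, _ => None
    end
  | _, _ => None
  end.

Definition step2 (i : 'I_n) (w : marked_word) : marked_word :=
  if i \in (T i.+1).2 then mark_leftmost_max w else w.

Definition bw (m : nat) : option marked_word :=
  foldl (fun ow i => omap (step2 i) (obind (step1 i) ow))
        (Some [::]) (take m (enum 'I_n)).

End Construction.

(* Main.v *)
Require Import Defs.
From mathcomp Require Import all_boot zify.

Set Implicit Arguments.
Unset Strict Implicit.
Unset Printing Implicit Defensive.

(* A partition of [n] read from left to right is a history: each integer either
   starts a block or closes the [k]-th largest open integer (counting from 0), and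
   it is then open or not. The partition is 2-distant noncrossing exactly when [k = 0], or
   [k = 1] and the preceding integer is open. Running the construction on such a
   history, the marks of the word are on first occurrences of letters, hence form
   a decreasing stack of letters, and the second case happens only when the
   largest letter [m] is marked. A letter [x < m] is marked if and only if it
   occurs again later; whether [m] is marked is read off the next letter [b]: if
   [b < m], it is marked if and only if [b] occurs again after that. So the word
   determines the history, and the pattern 12312 is what would make the letter
   to append differ from the two rightmost marked ones. *)

(** * Restricted growth words *)

(** The position [i] itself is excluded, and the empty prefix has maximum 0, so that restricted
    growth forces the first letter to be 1. *)
Definition pmax (a : nat -> nat) i := \max_(j < i) a j.

Lemma pmaxS a i : pmax a i.+1 = maxn (pmax a i) (a i).
Proof. by rewrite /pmax big_ord_recr. Qed.

Lemma leq_pmax a i j : j < i -> a j <= pmax a i.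
Proof. by move=> lt_ji; apply: (leq_bigmax (Ordinal lt_ji)). Qed.

Definition rgf (a : nat -> nat) n :=
  forall i, i < n -> 0 < a i <= (pmax a i).+1.

Lemma eq_pmax a b i : (forall j, j < i -> a j = b j) -> pmax a i = pmax b i.
Proof. by move=> eq_ab; apply: eq_bigr => j _; apply: eq_ab. Qed.

(** The running maximum grows by at most one at each position, so no positive value is skipped on
    the way up. *)
Lemma rgf_mem a n i x : rgf a n -> i <= n -> 0 < x <= pmax a i ->
  exists2 j, j < i & a j = x.
Proof.
move=> a_rgf; elim: i => [|i IHi] le_in x_bd.
  by move: x_bd; rewrite /pmax big_ord0; lia.
case: (leqP x (pmax a i)) => [le_x|gt_x].
  have [||j lt_ji <-] := IHi; [lia | lia |].
  by exists j => //; lia.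
by exists i => //; have := a_rgf i le_in; move: x_bd; rewrite pmaxS; lia.
Qed.

(** A letter either repeats an earlier one or is the running maximum plus one, and the equalities
    between letters tell which, so strong induction applies. *)
Lemma rgf_inj a b n : rgf a n -> rgf b n ->
    (forall i j, i < n -> j < n -> (a i == a j) = (b i == b j)) ->
  forall i, i < n -> a i = b i.
Proof.
move=> a_rgf b_rgf eq_ker; elim/ltn_ind=> i IHi lt_in.
have eq_mx: pmax a i = pmax b i by apply: eq_pmax => j ?; apply: IHi; lia.
have := a_rgf i lt_in; have := b_rgf i lt_in; rewrite -eq_mx => b_bd a_bd.
case: (leqP (a i) (pmax a i)) => [le_a|gt_a].
  have [||j lt_ji ej] := rgf_mem (x := a i) (i := i) a_rgf; [lia | lia |].
  have /eqP <- : b j == b i by rewrite -eq_ker ?ej //; lia.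
  by rewrite -ej IHi //; lia.
case: (leqP (b i) (pmax a i)) => [le_b|gt_b]; last lia.
have [||j lt_ji ej] := rgf_mem (x := b i) (i := i) b_rgf; [lia | lia |].
have /eqP : a j == a i by rewrite eq_ker ?ej //; lia.
by have := leq_pmax a lt_ji; lia.
Qed.

(** * Occurrences of the pattern 12312 in restricted growth words *)

Lemma subseq_cons_nth x s (w : seq nat) q :
  subseq (x :: s) (drop q w) <->
  exists p, [/\ q <= p < size w, nth 0 w p = x & subseq s (drop p.+1 w)].
Proof.
split.
  elim: w q => [|y w IHw] [|q] //=; last first.
    by case/IHw=> p [? ? ?]; exists p.+1.
  case: eqP => [->|_] sub; first by exists 0; rewrite drop0.
  have [|p [p_bd ep sp]] := IHw 0; first by rewrite drop0.
  by exists p.+1.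
case=> p [/andP[le_qp lt_pw] <- sub].
have -> : drop q w = drop 0 (drop q w) by rewrite drop0.
apply: (@subseq_trans _ (drop (p - q) (drop q w))); last first.
  by rewrite drop0 drop_subseq.
by rewrite drop_drop subnK // (drop_nth 0 lt_pw) /= eqxx.
Qed.

(** First occurrences appear in increasing order. Hence the final 1 and 2 of the pattern, with some
    larger letter before them, already force a full occurrence. *)
Lemma contains_12312 a n : rgf a n ->
  contains_pattern [:: 1; 2; 3; 1; 2] (mkseq a n) <->
  exists i j, [/\ i < j, j < n, a i < a j & a j < pmax a i].
Proof.
move=> a_rgf; split.
  case=> s; rewrite -[mkseq a n]drop0 => sub [].
  case: s sub => [|x1[|x2[|x3[|x4[|x5[|]]]]]] //=.
  case/subseq_cons_nth=> p1 [_ _].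
  case/subseq_cons_nth=> p2 [_ _].
  case/subseq_cons_nth=> p3 []; rewrite size_mkseq => b3 + +.
  rewrite nth_mkseq; last by lia.
  move=> e3 /subseq_cons_nth [p4 []]; rewrite size_mkseq => b4 + +.
  rewrite nth_mkseq; last by lia.
  move=> e4 /subseq_cons_nth [p5 []]; rewrite size_mkseq => b5 + _.
  rewrite nth_mkseq; last by lia.
  move=> e5 _ iso; exists p4, p5; split; [lia | lia | |].
    by rewrite e4 e5 -(iso 3 4).
  have : a p5 < a p3 by rewrite e3 e5 -(iso 4 2).
  by have := leq_pmax a (i := p4) (j := p3); lia.
case=> i [j [lt_ij lt_jn lt_ai lt_aj]].
have bi := a_rgf i (ltn_trans lt_ij lt_jn).
(* The pattern is built from right to left: an occurrence of the maximum before [i], one of [a j]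
   before it, then one of [a i] before that. Each exists because a smaller letter must precede a
   larger one. *)
have [||p3 lt3 e3] := rgf_mem (x := pmax a i) (i := i) a_rgf; [lia | lia |].
have b3 := a_rgf p3 (ltn_trans lt3 (ltn_trans lt_ij lt_jn)).
have [||p2 lt2 e2] := rgf_mem (x := a j) (i := p3) a_rgf; [lia | lia |].
have b2 := a_rgf p2 (ltn_trans lt2 (ltn_trans lt3 (ltn_trans lt_ij lt_jn))).
have [||p1 lt1 e1] := rgf_mem (x := a i) (i := p2) a_rgf; [lia | lia |].
exists [:: a i; a j; pmax a i; a i; a j].
  rewrite -[mkseq a n]drop0.
  apply/subseq_cons_nth; exists p1; rewrite size_mkseq nth_mkseq; last by lia.
  split=> //; first lia.
  apply/subseq_cons_nth; exists p2; rewrite size_mkseq nth_mkseq; last by lia.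
  split=> //; first lia.
  apply/subseq_cons_nth; exists p3; rewrite size_mkseq nth_mkseq; last by lia.
  split=> //; first lia.
  apply/subseq_cons_nth; exists i; rewrite size_mkseq nth_mkseq; last by lia.
  split=> //; first lia.
  apply/subseq_cons_nth; exists j; rewrite size_mkseq nth_mkseq; last by lia.
  split=> //; [lia | exact: sub0seq].
by split=> // -[|[|[|[|[|?]]]]] [|[|[|[|[|?]]]]] //= _ _; lia.
Qed.

(** * Canonical words are exactly the restricted growth words *)

Section CanonicalWords.

Variable n : nat.
Implicit Types (Q : {set {set 'I_n}}) (B : {set 'I_n}).

Lemma leq_block_min B i : i \in B -> block_min B <= i.
Proof.
rewrite /block_min => iB; have := mem_index_enum i.
elim: (index_enum _) => // j r IHr; rewrite big_cons inE.
case/orP=> [/eqP <-|/IHr le_i]; first by rewrite iB geq_minl.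
by case: ifP => // _; rewrite (leq_trans (geq_minr _ _)).
Qed.

Lemma block_minP B : B != set0 -> exists2 i, i \in B & block_min B = i.
Proof.
case/set0Pn=> i0 i0B.
have [i iB i_min] := @arg_minnP _ i0 (mem B) val i0B.
exists i => //; apply/eqP; rewrite eqn_leq leq_block_min //= /block_min.
elim/big_ind: _ => [|x y|j] //; first exact: ltnW.
  by rewrite leq_min => -> ->.
exact: i_min.
Qed.

Lemma size_canonical_word Q : size (canonical_word Q) = n.
Proof. by rewrite size_map size_enum_ord. Qed.

Lemma nth_canonical_word Q (i : 'I_n) :
  nth 0 (canonical_word Q) i = (index (pblock Q i) (blocks Q)).+1.
Proof. by rewrite (nth_map i) ?size_enum_ord ?nth_ord_enum. Qed.

(** If the block of [i] has index [k > 0], the block of index [k - 1] has a minimum at most that of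
    the block of [i]. This minimum is therefore an earlier position, and it carries the letter
    [k]. *)
Lemma canonical_word_rgf Q :
  partition Q [set: 'I_n] -> rgf (nth 0 (canonical_word Q)) n.
Proof.
case/and3P=> /eqP covQ trivQ Q0 i0 lt_i0n; pose i := Ordinal lt_i0n.
rewrite -[i0]/(val i) nth_canonical_word /= ltnS.
have inQ j : pblock Q j \in Q by rewrite pblock_mem // covQ.
have blocksE B : (B \in blocks Q) = (B \in Q) by rewrite mem_sort mem_enum.
set k := index _ _; case: (posnP k) => [-> //|k_gt0].
have lt_k: k < size (blocks Q) by rewrite index_mem blocksE.
pose B := nth set0 (blocks Q) k.-1.
have lt_k1 : k.-1 < size (blocks Q) := leq_ltn_trans (leq_pred k) lt_k.
have BQ : B \in Q by rewrite -blocksE mem_nth.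
have [j jB jmin] := block_minP (memPn Q0 _ BQ).
have pj : pblock Q j = B by apply: def_pblock.
have uQ : uniq (blocks Q) by rewrite sort_uniq enum_uniq.
have ij : (j < i)%N.
  have le_ji : j <= i.
    rewrite -jmin; apply: (@leq_trans (block_min (pblock Q i))); last first.
      by rewrite leq_block_min // mem_pblock covQ.
    have -> : pblock Q i = nth set0 (blocks Q) k by rewrite nth_index // blocksE.
    apply: (@sorted_leq_nth _ (fun C D => block_min C <= block_min D));
      rewrite ?inE // ?leq_pred //; first by move=> ? ? ?; apply: leq_trans.
    by apply: sort_sorted => C D; apply: leq_total.
  rewrite ltn_neqAle le_ji andbT; apply/eqP => /val_inj e_ji.
  by have := index_uniq set0 lt_k1 uQ; rewrite -/B -pj e_ji -/k; lia.
have := leq_pmax (nth 0 (canonical_word Q)) ij.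
by rewrite nth_canonical_word pj index_uniq // prednK.
Qed.

(** The partition is the one into level sets of [a]. Its canonical word and [a] are restricted
    growth words with the same equalities between letters, so [rgf_inj] identifies them. *)
Lemma rgf_canonical_word a : rgf a n ->
  exists2 Q : {set {set 'I_n}}, partition Q [set: 'I_n] &
    canonical_word Q = mkseq a n.
Proof.
move=> a_rgf; pose Q := preim_partition (a \o val) [set: 'I_n].
have partQ : partition Q [set: 'I_n] by apply: preim_partitionP.
exists Q => //; have [/eqP covQ trivQ Q0] := and3P partQ.
apply: (@eq_from_nth _ 0); rewrite ?size_mkseq ?size_canonical_word // => i lt_in.
rewrite nth_mkseq //; move: i lt_in.
apply: rgf_inj => //; first exact: canonical_word_rgf.
move=> i j lt_in lt_jn.
rewrite -[i]/(val (Ordinal lt_in)) -[j]/(val (Ordinal lt_jn)).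
rewrite !nth_canonical_word eqSS.
set x := Ordinal lt_in; set y := Ordinal lt_jn.
have inQ z : pblock Q z \in blocks Q by rewrite mem_sort mem_enum pblock_mem ?covQ.
have -> : (index (pblock Q x) (blocks Q) == index (pblock Q y) (blocks Q)) =
          (pblock Q x == pblock Q y).
  by apply/eqP/eqP => [e|->//]; exact: (index_inj set0 (inQ x) (inQ y) e).
rewrite eq_pblock ?covQ //.
by rewrite pblock_equivalence_partition // => ? ? ? _ _ _; split=> // /eqP ->.
Qed.

End CanonicalWords.

(** * Histories and their words *)

(** At each integer, [None] starts a block and [Some k] closes the open integer of index [k]; the
    boolean tells whether the integer itself is then open. Only the values below [n] matter for
    [valid n]. *)
Definition history := nat -> option nat * bool.

Implicit Types h : history.

Fixpoint opens h i : seq nat :=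
  if i is i'.+1 then
    let s := opens h i' in
    let s' := if (h i').1 is Some k then take k s ++ drop k.+1 s else s in
    if (h i').2 then i' :: s' else s'
  else [::].

Fixpoint top_letter h i : nat :=
  if i is i'.+1 then ((h i').1 == None) + top_letter h i' else 0.

(** Both cases of the construction unmark the rightmost marked letter, so [Some _] always pops the
    head, whatever the index. The letter pushed is the largest one after the step, a possible new
    letter included. *)
Fixpoint marks h i : seq nat :=
  if i is i'.+1 then
    let s := marks h i' in
    let s' := if (h i').1 is Some _ then behead s else s in
    if (h i').2 then top_letter h i :: s' else s'
  else [::].

Definition next_letter h i : nat :=
  if (h i).1 is Some k then nth 0 (marks h i) k else (top_letter h i).+1.

(** The condition for [k = 1] is phrased with marks; by [top_letter_marked] it says that the
    preceding integer is open. *)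
Definition valid n h :=
  (forall i k, i < n -> (h i).1 = Some k ->
     k < size (opens h i) /\ (k = 0 \/ k = 1 /\ top_letter h i \in marks h i))
  /\ opens h n = [::].

(** Each step pops and pushes equally on both stacks. Either bound is accepted because [rgf_history]
    controls the marks before anything is known about the open integers. *)
Lemma size_marks h n :
    (forall i k, i < n -> (h i).1 = Some k ->
       k < size (opens h i) \/ k < size (marks h i)) ->
  forall i, i <= n -> size (marks h i) = size (opens h i).
Proof.
move=> k_lt; elim=> [//|i IHi] lt_in.
have eq_sz := IHi (ltnW lt_in).
have: forall k, (h i).1 = Some k -> k < size (opens h i).
  by move=> k /(k_lt i k lt_in); rewrite eq_sz; case.
rewrite /=; case: (h i) => -[k|] [] /= lt_k; rewrite ?eq_sz //;
  have := lt_k k erefl; rewrite size_cat size_take size_drop size_behead;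
  by case: ltnP; lia.
Qed.

Lemma gtn_trans : transitive gtn.
Proof. by move=> y x z /= xy yz; apply: ltn_trans yz xy. Qed.

Lemma top_letterS h i : top_letter h i.+1 = ((h i).1 == None) + top_letter h i.
Proof. by []. Qed.

Definition pruned_marks h i :=
  if (h i).1 is Some _ then behead (marks h i) else marks h i.

Lemma marksS h i : marks h i.+1 =
  if (h i).2 then top_letter h i.+1 :: pruned_marks h i else pruned_marks h i.
Proof. by []. Qed.

Lemma sorted_consP (s : seq nat) x : sorted gtn s ->
  (forall y, y \in s -> y < x) -> sorted gtn (x :: s).
Proof. by case: s => //= y s -> ->; rewrite ?mem_head. Qed.

Lemma marks_spec h i :
  [/\ sorted gtn (marks h i),
      (forall x, x \in marks h i -> x <= top_letter h i),
      sorted gtn (pruned_marks h i) &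
      (forall x, x \in pruned_marks h i -> x < top_letter h i.+1)].
Proof.
have pruneP j : sorted gtn (marks h j) ->
    (forall x, x \in marks h j -> x <= top_letter h j) ->
    sorted gtn (pruned_marks h j) /\
    (forall x, x \in pruned_marks h j -> x < top_letter h j.+1).
  rewrite top_letterS /pruned_marks.
  move: (marks h j) => [|y s] s_sort s_bd; case: (h j).1 => [k|] //=; split=> //.
  - exact: path_sorted s_sort.
  - move=> x xs; have := s_bd y (mem_head _ _).
    have := s_bd x (@mem_behead _ (y :: s) x xs).
    have /allP/(_ x xs) /= := order_path_min gtn_trans s_sort; lia.
have [s_sort s_bd] : sorted gtn (marks h i) /\
    (forall x, x \in marks h i -> x <= top_letter h i).
  elim: i => [//|i [s_sort s_bd]]; have [s's s'bd] := pruneP i s_sort s_bd.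
  rewrite marksS; case: ifP => _; split=> //.
  - exact: sorted_consP.
  - by move=> x; rewrite inE => /orP[/eqP->//|/s'bd/ltnW].
  - by move=> x /s'bd/ltnW.
by have [] := pruneP i s_sort s_bd; split.
Qed.

Lemma top_letter_marked h i :
  (top_letter h i \in marks h i) = (0 < i) && (h i.-1).2.
Proof.
case: i => [//|i]; rewrite marksS; have [_ _ _ s'bd] := marks_spec h i.
case: ifP => _; first by rewrite mem_head.
by apply/negP => /s'bd; rewrite ltnn.
Qed.

Lemma mem_marksS h i x : x < top_letter h i.+1 ->
  (x \in marks h i.+1) = (x \in pruned_marks h i).
Proof. by move=> lt_x; rewrite marksS; case: ifP; rewrite ?inE // (ltn_eqF lt_x). Qed.

Lemma valid_size_marks n h : valid n h ->
  forall i, i <= n -> size (marks h i) = size (opens h i).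
Proof. by case=> v _; apply: size_marks => i k lt_i /(v i k lt_i)[]; left. Qed.

Lemma valid_marks_last n h : valid n h -> marks h n = [::].
Proof.
move=> v; apply/nilP; rewrite /nilp (valid_size_marks v) //.
by case: v => _ ->.
Qed.

(* The steps of a valid history: a new letter; the rightmost marked letter; or
   the second rightmost one, in which case the rightmost one is the top letter. *)
Variant step_spec (h : history) i :
    option nat -> nat -> seq nat -> seq nat -> nat -> Prop :=
| StepNew s : step_spec h i None (top_letter h i).+1 s s (top_letter h i).+1
| StepFirst x s : x <= top_letter h i -> (forall y, y \in s -> y < x) ->
    step_spec h i (Some 0) x (x :: s) s (top_letter h i)
| StepSecond x s : x < top_letter h i -> (forall y, y \in s -> y < x) ->
    step_spec h i (Some 1) x [:: top_letter h i, x & s] (x :: s) (top_letter h i).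

(** For index 1, validity puts the top letter in the stack. As it bounds a decreasing stack, it is
    the head. *)
Lemma stepP n h i : valid n h -> i < n ->
  step_spec h i (h i).1 (next_letter h i) (marks h i) (pruned_marks h i)
    (top_letter h i.+1).
Proof.
move=> v lt_i; have [s_sort s_bd _ _] := marks_spec h i.
have szE := valid_size_marks v (ltnW lt_i).
rewrite top_letterS /next_letter /pruned_marks.
have := v.1 i _ lt_i; case: (h i).1 => [k /(_ k erefl)|_]; last exact: StepNew.
rewrite -szE => -[].
case: (marks h i) s_sort s_bd => // x s s_sort s_bd lt_k [ek|[ek top_s]].
  rewrite ek /=; apply: StepFirst; first exact: s_bd (mem_head _ _).
  by apply/allP; apply: order_path_min s_sort; apply: gtn_trans.
rewrite ek /= in lt_k *; case: s => // y s in s_sort s_bd lt_k top_s *.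
have lt_s : forall z, z \in y :: s -> z < x.
  by apply/allP; apply: order_path_min s_sort; apply: gtn_trans.
have ex : x = top_letter h i.
  have le_x := s_bd x (mem_head _ _).
  by move: top_s; rewrite inE => /orP[/eqP//|/lt_s]; lia.
rewrite ex; apply: StepSecond; first by rewrite -ex lt_s ?mem_head.
by apply/allP; apply: order_path_min (path_sorted s_sort); apply: gtn_trans.
Qed.

Lemma top_letter_pmax n h : valid n h ->
  forall i, i <= n -> top_letter h i = pmax (next_letter h) i.
Proof.
move=> v; elim=> [|i IHi] lt_i; first by rewrite /pmax big_ord0.
rewrite pmaxS -IHi; last lia.
by case: (stepP v lt_i) => *; lia.
Qed.

(** * Marks read off from the later letters, and recovery of the history *)

Definition occurs (a : nat -> nat) n x i := has (fun j => a j == x) (iota i (n - i)).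

Lemma occursP a n x i :
  reflect (exists2 j, i <= j < n & a j = x) (occurs a n x i).
Proof.
apply: (iffP hasP) => -[j]; rewrite ?mem_iota.
  by move=> j_bd /eqP; exists j => //; lia.
by move=> j_bd /eqP; exists j => //; rewrite mem_iota; lia.
Qed.

Lemma occursS a n x i : i < n ->
  occurs a n x i = (a i == x) || occurs a n x i.+1.
Proof. by move=> lt_i; rewrite /occurs -(@subnSK i n). Qed.

Lemma occurs_last a n x : occurs a n x n = false.
Proof. by rewrite /occurs subnn. Qed.

(** Backward induction from [n], where the stack is empty. A letter below the top is never pushed
    again, and it leaves the stack only when it is appended by a step of the first kind; a step of
    the second kind appends a letter that stays marked, and pops the top letter. *)
Lemma mem_marks n h : valid n h -> forall i x, i <= n -> x < top_letter h i ->
  (x \in marks h i) = occurs (next_letter h) n x i.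
Proof.
move=> v i x le_i; rewrite -(subKn le_i); move: (n - i) (leq_subr i n) => d.
elim: d => [|d IHd] le_d lt_x.
  by rewrite subn0 (valid_marks_last v) occurs_last.
have := IHd (ltnW le_d).
have lt_nd : n - d.+1 < n by lia.
have -> : n - d = (n - d.+1).+1 by lia.
move: (n - d.+1) lt_nd lt_x => {IHd le_d d le_i} j lt_j lt_x.
have le_top : top_letter h j <= top_letter h j.+1 by rewrite top_letterS leq_addl.
move/(_ (leq_trans lt_x le_top)); rewrite mem_marksS; last lia.
rewrite (occursS _ _ lt_j) => <-.
case: (stepP v lt_j) => [s|y s _ _|y s lt_y lt_s].
- by rewrite gtn_eqF //; lia.
- by rewrite inE eq_sym.
- by rewrite !inE (ltn_eqF lt_x) orFb [y == x]eq_sym orbA orbb.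
Qed.

Lemma valid_marks_gt0 n h : valid n h -> forall i x, i <= n ->
  x \in marks h i -> 0 < x.
Proof.
move=> v; elim=> [//|i IHi] x lt_i.
have {}IHi := IHi _ (ltnW lt_i); rewrite marksS.
have s'_gt0: forall y, y \in pruned_marks h i -> 0 < y.
  move=> y ys; apply: IHi; move: ys; rewrite /pruned_marks.
  by case: (h i).1 => [_|]//; apply: mem_behead.
case: ifP => _; last exact: s'_gt0.
rewrite inE => /orP[/eqP->|/s'_gt0//].
case: (stepP v lt_i) IHi => //= y s le_y; first by move=> _ /(_ y (mem_head _ _)); lia.
by move=> _ /(_ _ (mem_head _ _)).
Qed.

Lemma next_letter_rgf n h : valid n h -> rgf (next_letter h) n.
Proof.
move=> v i lt_i; rewrite -(top_letter_pmax v) ?(ltnW lt_i) //.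
have := @valid_marks_gt0 n h v i _ (ltnW lt_i).
case: (stepP v lt_i) => [s _|x s le_x _ x_gt0|x s lt_x _ x_gt0]; first lia.
  by rewrite x_gt0 ?mem_head; lia.
by rewrite x_gt0 ?inE ?eqxx ?orbT; lia.
Qed.

(** By [mem_marks] the letter appended at [j] is marked at [i]. But the step at [i] uses the head of
    the stack, or the second entry when the head is the top letter, so no marked letter lies
    strictly between the appended letter and the top. *)
Lemma next_letter_avoids n h i j : valid n h -> i < j -> j < n ->
  next_letter h i < next_letter h j -> next_letter h j < top_letter h i -> False.
Proof.
move=> v lt_ij lt_j lt_a lt_top; have lt_i := ltn_trans lt_ij lt_j.
have: next_letter h j \in marks h i.
  by rewrite (mem_marks v) ?(ltnW lt_i) //; apply/occursP; exists j; lia.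
case: (stepP v lt_i) lt_a => [s|x s _ lt_s|x s _ lt_s]; first lia.
  by rewrite inE => + /orP[/eqP|/lt_s]; lia.
by rewrite !inE => + /or3P[/eqP|/eqP|/lt_s]; lia.
Qed.

(* Whether the largest letter among the first [i] letters of [a] is marked is
   read off the next letter. *)
Definition top_marked a n i :=
  (i < n) && if a i < pmax a i then occurs a n (a i) i.+1
             else occurs a n (pmax a i) i.

(** When the next letter is below the top, the top is marked exactly for a step of the second kind,
    that is, when the appended letter stays marked and hence recurs. Otherwise, the top is marked
    exactly when it occurs again. *)
Lemma mem_top_letter n h i : valid n h -> i <= n ->
  (top_letter h i \in marks h i) = top_marked (next_letter h) n i.
Proof.
move=> v le_i; rewrite /top_marked; case: ltnP => [lt_i|le_n] /=; last first.
  by have -> : i = n by [lia]; rewrite (valid_marks_last v).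
rewrite -(top_letter_pmax v) //.
rewrite [occurs _ _ (top_letter h i) i]occursS //.
have := mem_marks v lt_i; have := @mem_marksS h i.
case: (stepP v lt_i) => [s|x s le_x lt_s|x s lt_x lt_s] memS memO.
- by rewrite ltnNge leqnSn /= gtn_eqF // -memO // memS.
- case: ltnP => [lt_x|ge_x]; last first.
    by have -> : x = top_letter h i by [lia]; rewrite mem_head eqxx.
  rewrite -memO // memS // inE gtn_eqF //=.
  have /negPf-> : x \notin s by apply/negP => /lt_s; rewrite ltnn.
  by apply/negP => /lt_s; lia.
- by rewrite lt_x -memO // memS // !mem_head.
Qed.

(** The word determines the top letters, the marks below the top and the mark of the top, hence the
    whole decreasing stack at every time. *)
Lemma valid_inj n h h' : valid n h -> valid n h' ->
    (forall i, i < n -> next_letter h i = next_letter h' i) ->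
  forall i, i < n -> h i = h' i.
Proof.
move=> v v' eq_a.
have eq_top i : i <= n -> top_letter h i = top_letter h' i.
  move=> le_i; rewrite (top_letter_pmax v) // (top_letter_pmax v') //.
  by apply: eq_pmax => j lt_j; apply: eq_a; lia.
have eq_occ x i : occurs (next_letter h) n x i = occurs (next_letter h') n x i.
  by apply/occursP/occursP => -[j j_bd <-]; exists j => //; rewrite eq_a //; lia.
have eq_mtop i : i <= n ->
    (top_letter h i \in marks h i) = (top_letter h' i \in marks h' i).
  move=> le_i; rewrite (mem_top_letter v) // (mem_top_letter v') // /top_marked.
  case: ltnP => //= lt_i; rewrite -(top_letter_pmax v) // -(top_letter_pmax v') //.
  by rewrite eq_a // eq_top // !eq_occ.
have eq_marks i : i <= n -> marks h i = marks h' i.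
  move=> le_i; have [s_sort s_bd _ _] := marks_spec h i.
  have [s'_sort s'_bd _ _] := marks_spec h' i.
  apply: (irr_sorted_eq gtn_trans) => // [x|x]; first exact: ltnn.
  case: (ltngtP x (top_letter h i)) => [lt_x|gt_x|->].
  - by rewrite (mem_marks v) // (mem_marks v') -?eq_top // eq_occ.
  - apply/idP/idP => [/s_bd|/s'_bd]; rewrite -?eq_top //; lia.
  - by rewrite {2}eq_top // eq_mtop.
(* The boolean is the mark of the top letter after the step. The kind of step is seen on the common
   stack: the appended letter is new, or the head, or different from the head. *)
move=> i lt_i; apply: (@injective_projections _ _ (h i) (h' i)); last first.
  have := top_letter_marked h i.+1; have := top_letter_marked h' i.+1.
  by rewrite eq_mtop //= => -> ->.
have := eq_a i lt_i; have := eq_top i (ltnW lt_i); have := eq_marks i (ltnW lt_i).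
case: (stepP v lt_i) => [s|x s le_x _|x s lt_x _];
  case: (stepP v' lt_i) => [s'|x' s' le_x' _|x' s' lt_x' _] //; try lia.
- by case=> ex _ et; lia.
- by case=> ex _ et; lia.
Qed.

(** The history is defined by the reading rules that [mem_marks] and [mem_top_letter] force. That
    these rules hold is then proved as an invariant, by forward induction. *)
Lemma rgf_history a n : rgf a n ->
    (forall i j, i < j -> j < n -> a i < a j -> a j < pmax a i -> False) ->
  exists2 h, valid n h & forall i, i < n -> next_letter h i = a i.
Proof.
move=> a_rgf a_avoid.
pose h : history := fun i =>
  (if pmax a i < a i then None
   else if (a i < pmax a i) && occurs a n (a i) i.+1 then Some 1 else Some 0,
   top_marked a n i.+1).
have topE i : i <= n -> top_letter h i = pmax a i.
  elim: i => [|i IHi] lt_i; first by rewrite /pmax big_ord0.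
  rewrite top_letterS IHi 1?ltnW // pmaxS /=.
  have := a_rgf i lt_i.
  by case: (ltnP (pmax a i)) => [|?] /=; [lia | case: ifP => _ /=; lia].
have occ_lt i x : occurs a n x i -> x != a i -> occurs a n x i.+1.
  move=> /occursP[j j_bd <-] ne_a; apply/occursP; exists j => //.
  by case: (ltngtP i j) ne_a => [|?|->]; rewrite ?eqxx //; lia.
pose markedE i := forall x, (x \in marks h i) =
  (x < pmax a i) && occurs a n x i || (x == pmax a i) && top_marked a n i.
have step i : i < n -> markedE i ->
    [/\ next_letter h i = a i,
        forall x, x < pmax a i.+1 -> (x \in pruned_marks h i) = occurs a n x i.+1 &
        forall k, (h i).1 = Some k ->
          k < size (marks h i) /\ (k = 0 \/ k = 1 /\ top_letter h i \in marks h i)].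
  rewrite /markedE => lt_i memE; have ai_bd := a_rgf i lt_i.
  have [s_sort s_bd _ _] := marks_spec h i.
  rewrite /next_letter /pruned_marks pmaxS !(topE _ (ltnW lt_i)) in s_bd *.
  (* This is where avoidance enters: a marked letter strictly between [a i] and the maximum would
     occur again after [i] and complete the pattern. *)
  have between z : z \in marks h i -> a i < z -> z < pmax a i -> False.
    rewrite memE => /orP[/andP[_ /(occ_lt i)]|/andP[/eqP ->]]; last by rewrite ltnn.
    move=> occ_z lt_az lt_z; have /occursP[j j_bd ej] : occurs a n z i.+1.
      by rewrite occ_z // gtn_eqF.
    by apply: (a_avoid i j); lia.
  rewrite /=; case: ltnP => [gt_a|le_a] /=.
    split=> // [|x]; first lia.
    have -> : a i = (pmax a i).+1 by lia.
    rewrite ltnS memE /top_marked lt_i leq_eqVlt => /orP[/eqP->|lt_x].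
      by rewrite ltnn eqxx /= [a i < _]ltnNge (ltnW gt_a) /= occursS ?gtn_eqF.
    by rewrite lt_x (ltn_eqF lt_x) orbF occursS ?gtn_eqF //; lia.
  case: ifP => [/andP[lt_a occ_a]|no_occ].
    (* The letter [a i] recurs, so the maximum is marked as well as [a i]. By [between] they are the
       first two entries of the stack, as index 1 requires. *)
    have top_s : pmax a i \in marks h i.
      by rewrite memE ltnn eqxx /top_marked lt_i lt_a occ_a.
    have a_s : a i \in marks h i by rewrite memE lt_a occursS // eqxx.
    case: (marks h i) memE s_sort s_bd between top_s a_s =>
      // y s memE /= ys s_bd between.
    have s_lt : forall z, z \in s -> z < y.
      by apply/allP; apply: order_path_min ys; apply: gtn_trans.
    have le_y := s_bd y (mem_head _ _).
    have s_sort := path_sorted ys.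
    rewrite inE => /orP[/eqP ey|/s_lt]; last lia.
    rewrite -ey inE (ltn_eqF lt_a) /= => a_s; rewrite -{}ey in s_lt between memE *.
    case: s {ys} s_sort a_s s_lt memE between {s_bd} => // z s zs a_s s_lt memE between.
    have ez : z = a i.
      have lt_z := s_lt z (mem_head _ _).
      move: a_s; rewrite inE => /orP[/eqP//|az].
      have /allP/(_ _ az)/= := order_path_min gtn_trans zs => az'.
      by case: (between z); rewrite ?inE ?eqxx ?orbT.
    split=> [|x lt_x|k [<-]]; last by rewrite eqxx; split=> //; right.
      by rewrite ez.
    have := memE x; rewrite lt_x in_cons (ltn_eqF lt_x) orbF /= => ->.
    rewrite occursS //; case: eqP => //= <-; exact: esym.
  have a_s : a i \in marks h i.
    rewrite memE; case: (ltngtP (a i) (pmax a i)) le_a => //= [_|ea] _.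
      by rewrite occursS // eqxx.
    by rewrite /top_marked lt_i ea ltnn occursS // ea eqxx.
  case: (marks h i) memE s_sort s_bd between a_s => // y s memE /= ys s_bd between a_s.
  have s_lt : forall z, z \in s -> z < y.
    by apply/allP; apply: order_path_min ys; apply: gtn_trans.
  (* A larger head could only be the maximum, by [between]; but a marked maximum above [a i] would
     mean that [a i] recurs, which [no_occ] excludes. *)
  have ey : y = a i.
    move: a_s; rewrite inE => /orP[/eqP//|/s_lt lt_a].
    have le_y := s_bd y (mem_head _ _).
    case: (ltngtP y (pmax a i)) le_y => // [lt_y|ey] _.
      by case: (between y); rewrite ?mem_head.
    have := memE y; rewrite mem_head ey ltnn eqxx /top_marked lt_i -ey lt_a /=.
    by move: no_occ; rewrite -ey lt_a /= => ->.
  split=> // [x lt_x|k [<-]]; last by split=> //; left.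
  have := memE x; rewrite lt_x in_cons (ltn_eqF lt_x) orbF /= occursS // ey.
  rewrite eq_sym; case: eqP => //= ex _; rewrite -ex in lt_x *.
  move: no_occ; rewrite lt_x /= => ->.
  by apply/negP => /s_lt; rewrite ey ltnn.
have memE i : i <= n -> markedE i.
  elim: i => [|i IHi] lt_i x.
    rewrite /top_marked /pmax big_ord0 ltn0 in_nil.
    case: ltnP => [lt_0|_]; rewrite ?andbF //=; apply/esym/andP => -[_].
    by case/occursP=> j j_bd aj; have := a_rgf j; lia.
  have [_ mem_s' _] := step i lt_i (IHi (ltnW lt_i)).
  have [_ s_bd _ _] := marks_spec h i.+1.
  rewrite -(topE _ lt_i) in mem_s' *.
  case: (ltngtP x (top_letter h i.+1)) => [lt_x|gt_x|->].
  - by rewrite mem_marksS // mem_s' //= orbF.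
  - by apply/negP => /s_bd; lia.
  - by rewrite top_letter_marked.
have szE i : i <= n -> size (marks h i) = size (opens h i).
  apply: size_marks => j k lt_j ek; right.
  by have [_ _ /(_ k ek)[]] := step j lt_j (memE j (ltnW lt_j)).
exists h => [|i lt_i]; last by have [] := step i lt_i (memE i (ltnW lt_i)).
split=> [i k lt_i ek|].
  have [_ _ /(_ k ek)] := step i lt_i (memE i (ltnW lt_i)).
  by rewrite szE // ltnW.
apply/nilP; rewrite /nilp -szE //.
have := memE n (leqnn n); rewrite /markedE; case: (marks h n) => // x s /(_ x).
by rewrite mem_head occurs_last /top_marked ltnn !andbF.
Qed.

(** * Edges of a partition *)

(** The left neighbour of [j] in its block, if any. The default 0 of [nth] is harmless once the
    index is known to be within the stack. *)
Definition mate h j : option nat := omap (nth 0 (opens h j)) (h j).1.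

Lemma opens_spec h i :
  sorted gtn (opens h i) /\ (forall x, x \in opens h i -> x < i).
Proof.
elim: i => [//|i [s_sort s_lt]] /=.
set s' := if (h i).1 is Some _ then _ else _.
have subs : subseq s' (opens h i).
  rewrite /s'; case: (h i).1 => // k.
  rewrite -{3}(cat_take_drop k (opens h i)) cat_subseq //.
  by rewrite -add1n -drop_drop drop_subseq.
have s's := subseq_sorted gtn_trans subs s_sort.
have s'lt x : x \in s' -> x < i by move/(mem_subseq subs); apply: s_lt.
case: ifP => _; split=> //; first exact: sorted_consP.
  by move=> x; rewrite inE => /orP[/eqP->//|/s'lt]; lia.
by move=> x /s'lt; lia.
Qed.

Lemma opens_uniq h i : uniq (opens h i).
Proof.
have [s_sort _] := opens_spec h i.
apply: (sorted_uniq gtn_trans) s_sort => x; exact: ltnn.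
Qed.

(** The stack has no repetition, so deleting an entry by index deletes exactly that integer. *)
Lemma mem_opensS h i x :
    (forall k, (h i).1 = Some k -> k < size (opens h i)) ->
  (x \in opens h i.+1) =
    (x == i) && (h i).2 || (x \in opens h i) && (mate h i != Some x).
Proof.
move=> lt_k /=; set s' := if (h i).1 is Some _ then _ else _.
have -> : (x \in opens h i) && (mate h i != Some x) = (x \in s').
  rewrite /s' /mate; case: (h i).1 lt_k => [k|] lt_k; last by rewrite andbT.
  have {}lt_k := lt_k k erefl; have := opens_uniq h i.
  rewrite -{1 2}(cat_take_drop k (opens h i)) (drop_nth 0 lt_k) /=.
  set y := nth _ _ _; rewrite cat_uniq /= => /and3P[_ /norP[y_take _] /andP[y_drop _]].
  rewrite !mem_cat inE (inj_eq Some_inj) [y == x]eq_sym.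
  case: eqP => [->|_] /=; first by rewrite (negPf y_take) (negPf y_drop) andbF.
  by rewrite andbT.
by case: ifP => _; rewrite ?inE ?andbT ?andbF.
Qed.

Section Edges.

Variables (n : nat) (P : {set {set 'I_n}}).
Hypothesis partP : partition P [set: 'I_n].
Implicit Types i j k : 'I_n.

Lemma is_edgeP i j :
  reflect [/\ i < j, i \in pblock P j & forall t, t \in pblock P j -> ~~ (i < t < j)]
          (is_edge P i j).
Proof.
have [/eqP covP trivP P0] := and3P partP.
apply: (iffP andP) => [[lt_ij /exists_inP[B BP /and3P[iB jB /forall_inP tB]]]|].
  by rewrite (def_pblock trivP BP jB).
case=> lt_ij i_j t_j; split=> //; apply/exists_inP; exists (pblock P j).
  by rewrite pblock_mem ?covP.
by rewrite i_j mem_pblock covP inE; apply/forall_inP.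
Qed.

Lemma partition_same_pblock i j : i \in pblock P j -> pblock P i = pblock P j.
Proof. by have [_ trivP _] := and3P partP; apply: same_pblock. Qed.

Lemma mem_pblock_id i : i \in pblock P i.
Proof. by have [/eqP covP _ _] := and3P partP; rewrite mem_pblock covP. Qed.

Lemma is_edge_lt i j : is_edge P i j -> i < j.
Proof. by case/andP. Qed.

Lemma pred_edge_inj i i' j : is_edge P i j -> is_edge P i' j -> i = i'.
Proof.
move=> /is_edgeP[lt_ij i_j t_ij] /is_edgeP[lt_i'j i'_j t_i'j]; apply: val_inj => /=.
by have := t_ij _ i'_j; have := t_i'j _ i_j; lia.
Qed.

Lemma succ_edge_inj i j j' : is_edge P i j -> is_edge P i j' -> j = j'.
Proof.
move=> /is_edgeP[lt_ij i_j t_ij] /is_edgeP[lt_ij' i_j' t_ij']; apply: val_inj => /=.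
have eq_b : pblock P j = pblock P j'.
  by rewrite -(partition_same_pblock i_j) (partition_same_pblock i_j').
have := t_ij j'; have := t_ij' j.
rewrite -eq_b {2}eq_b !mem_pblock_id => /(_ isT) + /(_ isT); lia.
Qed.

Lemma connectedE i k : i < k -> connected P i k = is_edge P i k.
Proof.
move=> lt_ik; rewrite /connected [is_edge P k i]/is_edge ltnNge.
by rewrite (ltnW lt_ik) orbF.
Qed.

Lemma connectedC i k : connected P i k = connected P k i.
Proof. by rewrite /connected orbC. Qed.

Lemma mem_T2 m i :
  (i \in (T P m).2) = (i < m) && [exists k : 'I_n, (m <= k) && is_edge P i k].
Proof.
rewrite inE; case: ltnP => //= lt_im; apply: eq_existsb => k.
by case: leqP => //= le_mk; rewrite connectedE //; lia.
Qed.

Lemma mem_marked_integers m i :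
  (val i \in map val (marked_integers P m)) =
    (i < m) && [exists k : 'I_n, (m <= k) && is_edge P i k].
Proof. by rewrite mem_map ?mem_rev ?mem_enum ?mem_T2 //; apply: val_inj. Qed.

Lemma marked_integers_sorted m : sorted gtn (map val (marked_integers P m)).
Proof.
rewrite map_rev rev_sorted /=; apply: (subseq_sorted _ _ (iota_ltn_sorted 0 n)).
  by move=> ? ? ?; apply: ltn_trans.
rewrite -val_enum_ord map_subseq // [enum (ordinal _)]enumT; exact: filter_subseq.
Qed.

Definition represents h := forall j : 'I_n,
  (forall i, is_edge P i j = (mate h j == Some (val i))) /\
  (h j).2 = [exists k : 'I_n, is_edge P j k].

(** Both lists are strictly decreasing, so it suffices to compare members. An earlier integer
    remains open exactly when its only edge to the right does not end at [j]. *)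
Lemma opens_step h j :
    opens h j = map val (marked_integers P j) ->
    (forall i, is_edge P i j = (mate h j == Some (val i))) ->
    (h j).2 = [exists k : 'I_n, is_edge P j k] ->
    (forall k : nat, (h j).1 = Some k -> k < size (opens h j)) ->
  opens h j.+1 = map val (marked_integers P j.+1).
Proof.
move=> opensE edgeE markE lt_k; have [s_sort s_lt] := opens_spec h j.+1.
apply: (irr_sorted_eq gtn_trans) => [x|//||x]; first exact: ltnn.
- exact: marked_integers_sorted.
case: (ltnP x n) => [lt_xn|le_nx]; last first.
  apply/idP/mapP => [/s_lt lt_x|[y _ ex]].
    by have := leq_trans lt_x (leq_trans (ltn_ord j) le_nx); rewrite ltnn.
  by move: (ltn_ord y); rewrite ltnNge -[nat_of_ord y]/(val y) -ex le_nx.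
pose i := Ordinal lt_xn; rewrite -[x]/(val i).
rewrite mem_opensS // opensE !mem_marked_integers -edgeE markE ltnS [i <= j]leq_eqVlt.
case: (eqVneq (i : nat) j) => [/val_inj->|ne_ij] /=.
  rewrite ltnn /= orbF; apply: eq_existsb => k.
  by case: leqP => //= le_kj; apply/negP => /is_edge_lt; lia.
rewrite -andbA; case: ltnP => //= lt_ij.
apply/andP/existsP => [[/existsP[k /andP[le_jk e_ik]] not_ij]|[k /andP[lt_jk e_ik]]].
  exists k; rewrite e_ik andbT ltn_neqAle le_jk andbT.
  by apply: contraNneq not_ij => /val_inj->.
split; first by apply/existsP; exists k; rewrite e_ik ltnW.
by apply/negP => /(succ_edge_inj e_ik) ek; move: lt_jk; rewrite ek ltnn.
Qed.

Lemma opens_marked_integers h : represents h ->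
    (forall (i k : nat), i < n -> (h i).1 = Some k -> k < size (opens h i)) ->
  forall i : nat, i <= n -> opens h i = map val (marked_integers P i).
Proof.
move=> repr lt_k; elim=> [_|i IHi lt_i].
  rewrite /marked_integers; case: (enum _) (mem_enum (T P 0).2) => // x s /(_ x).
  by rewrite mem_head mem_T2 ltn0.
have [edgeE markE] := repr (Ordinal lt_i).
apply: (opens_step (j := Ordinal lt_i)) => // [|k /(lt_k i k lt_i) //].
by rewrite IHi 1?ltnW.
Qed.

End Edges.

(** * The marked words of a history *)

Definition new h j : bool := (h j).1 == None.

(* Only first occurrences of letters are ever marked, so a marked word is given
   by its letters and the set [S] of its marked letters. *)
Definition word_with_marks h (S : seq nat) i : marked_word :=
  mkseq (fun j => (next_letter h j, new h j && (next_letter h j \in S))) i.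

Lemma size_word_with_marks h S i : size (word_with_marks h S i) = i.
Proof. exact: size_mkseq. Qed.

Lemma nth_word_with_marks h S i p : p < i ->
  nth (0, false) (word_with_marks h S i) p =
    (next_letter h p, new h p && (next_letter h p \in S)).
Proof. exact: nth_mkseq. Qed.

Lemma letter_word_with_marks h S i p : p < i ->
  letter (word_with_marks h S i) p = next_letter h p.
Proof. by move=> lt_p; rewrite /letter nth_word_with_marks. Qed.

Lemma word_with_marksS h S i : word_with_marks h S i.+1 =
  rcons (word_with_marks h S i) (next_letter h i, new h i && (next_letter h i \in S)).
Proof. exact: mkseqS. Qed.

Lemma new_letterE h j : new h j -> next_letter h j = (top_letter h j).+1.
Proof. by rewrite /new /next_letter => /eqP->. Qed.

Lemma top_letter_homo h i j : i <= j -> top_letter h i <= top_letter h j.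
Proof.
move/subnK <-; elim: (j - i) => // d IHd.
by rewrite addSn top_letterS (leq_trans IHd) ?leq_addl.
Qed.

Lemma new_letter_mono h p q : p < q -> new h p -> new h q ->
  next_letter h p < next_letter h q.
Proof.
move=> lt_pq new_p new_q; rewrite !new_letterE // ltnS.
by have := top_letter_homo h lt_pq; rewrite top_letterS (eqP new_p).
Qed.

Lemma new_letter_inj h p q : new h p -> new h q ->
  next_letter h p = next_letter h q -> p = q.
Proof.
move=> new_p new_q e.
case: (ltngtP p q) => // [/(@new_letter_mono h)|/(@new_letter_mono h)].
  by rewrite e ltnn => /(_ new_p new_q).
by rewrite e ltnn => /(_ new_q new_p).
Qed.

Lemma new_letter_exists h i x : 0 < x <= top_letter h i ->
  exists p, [/\ p < i, new h p & next_letter h p = x].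
Proof.
elim: i => [|i IHi]; first by rewrite /=; lia.
rewrite top_letterS => x_bd.
case: (leqP x (top_letter h i)) => [le_x|gt_x].
  have [|p [lt_p new_p ep]] := IHi; first lia.
  by exists p; split=> //; apply: ltnW.
have new_i : new h i by move: x_bd; rewrite /new; case: eqP => // _; lia.
exists i; split=> //; rewrite new_letterE //.
by move: x_bd; rewrite (eqP new_i) eqxx; lia.
Qed.

(** Each letter is new at only one position, so clearing the mark there amounts to removing the
    letter from the marked set. *)
Lemma set_mark_false h S i p y : p < i -> new h p -> next_letter h p = y ->
  y \notin S ->
  set_mark (word_with_marks h (y :: S) i) p false = word_with_marks h S i.
Proof.
move=> lt_p new_p ep yS; rewrite /set_mark letter_word_with_marks //.
apply: (@eq_from_nth _ (0, false)).
  by rewrite size_set_nth !size_word_with_marks (maxn_idPr _).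
move=> q; rewrite size_set_nth size_word_with_marks (maxn_idPr _) // => lt_q.
rewrite nth_set_nth /= !nth_word_with_marks //; case: eqP => [->|ne_qp].
  by rewrite ep (negPf yS) andbF.
rewrite inE; case: eqP => [eq_y|//]; congr pair; case new_q: (new h q) => //=.
by case: ne_qp; apply: (@new_letter_inj h); rewrite ?ep.
Qed.

Lemma set_mark_true h S i p y : p < i -> new h p -> next_letter h p = y ->
  set_mark (word_with_marks h S i) p true = word_with_marks h (y :: S) i.
Proof.
move=> lt_p new_p ep; rewrite /set_mark letter_word_with_marks //.
apply: (@eq_from_nth _ (0, false)).
  by rewrite size_set_nth !size_word_with_marks (maxn_idPr _).
move=> q; rewrite size_set_nth size_word_with_marks (maxn_idPr _) // => lt_q.
rewrite nth_set_nth /= !nth_word_with_marks //; case: eqP => [->|ne_qp].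
  by rewrite ep new_p mem_head.
rewrite inE; case: eqP => [eq_y|//]; congr pair; case new_q: (new h q) => //=.
by case: ne_qp; apply: (@new_letter_inj h); rewrite ?ep.
Qed.

Lemma max_letter_word h S i :
  max_letter (word_with_marks h S i) = pmax (next_letter h) i.
Proof.
rewrite /max_letter big_map /pmax -(big_mkord xpredT (next_letter h)).
by rewrite /index_iota subn0.
Qed.

(** The leftmost occurrence of the largest letter is the position where it was introduced, since all
    letters before that are smaller. *)
Lemma mark_leftmost_maxE n h S i : valid n h -> i <= n -> 0 < top_letter h i ->
  mark_leftmost_max (word_with_marks h S i) = word_with_marks h (top_letter h i :: S) i.
Proof.
move=> v le_i top_gt0; rewrite /mark_leftmost_max max_letter_word -(top_letter_pmax v) //.
have [|q [lt_q new_q eq]] := @new_letter_exists h i (top_letter h i).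
  by rewrite top_gt0 leqnn.
set pr := fun _ => _; set w := word_with_marks h S i.
suff -> : find pr w = q by apply: set_mark_true.
have prE p : p < i -> pr (nth (0, false) w p) = (next_letter h p == top_letter h i).
  by move=> lt_p; rewrite /pr nth_word_with_marks.
have has_pr : has pr w.
  apply/(has_nthP (0, false)); exists q; first by rewrite size_word_with_marks.
  by rewrite prE // eq.
have lt_f : find pr w < i by rewrite -[ltnRHS](size_word_with_marks h S i) -has_find.
case: (ltngtP (find pr w) q) => // [lt_fq|lt_qf].
  have := nth_find (0, false) has_pr; rewrite prE // -eq => /eqP ef.
  have := leq_pmax (next_letter h) lt_fq.
  by rewrite -(top_letter_pmax v) ?ef ?new_letterE // ?ltnn //; lia.
by have := before_find (0, false) lt_qf; rewrite prE // eq eqxx.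
Qed.

(** New letters increase from left to right, so reading marked positions from the right yields a
    decreasing list with the members of the stack. *)
Lemma marked_positions_letters n h i : valid n h -> i <= n ->
  map (next_letter h) (marked_positions (word_with_marks h (marks h i) i)) = marks h i.
Proof.
move=> v le_i; have [s_sort s_bd _ _] := marks_spec h i.
rewrite /marked_positions size_word_with_marks map_rev.
set s := filter _ _.
have sP p : (p \in s) = [&& p < i, new h p & next_letter h p \in marks h i].
  rewrite mem_filter mem_iota add0n /= andbC; case: ltnP => //= lt_p.
  by rewrite nth_word_with_marks.
apply: (irr_sorted_eq gtn_trans) => [x||//|x]; first exact: ltnn.
  rewrite rev_sorted; apply: (@homo_sorted_in _ _ (mem s) _ ltn).
  - move=> p q; rewrite !sP => /and3P[_ new_p _] /and3P[_ new_q _] lt_pq.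
    exact: new_letter_mono.
  - by apply/allP.
  - by apply: sorted_filter (iota_ltn_sorted _ _) => ? ? ?; apply: ltn_trans.
rewrite mem_rev; apply/mapP/idP => [[p]|xs]; first by rewrite sP => /and3P[_ _ ?] ->.
have [|p [lt_p new_p ep]] := @new_letter_exists h i x.
  by rewrite (valid_marks_gt0 v le_i xs) s_bd.
by exists p => //; rewrite sP lt_p new_p ep.
Qed.

(** * The construction run on a partition follows the history that represents it *)

Section Run.

Variables (n : nat) (P : {set {set 'I_n}}) (h : history).
Hypotheses (partP : partition P [set: 'I_n]) (v : valid n h) (repr : represents P h).

(** Cutting off large integers creates no edge, because whatever separates two remaining elements of
    a block also remains. *)
Lemma is_edge_restrict m (i j : 'I_n) :
  is_edge (T P m).1 i j = is_edge P i j && (j < m).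
Proof.
rewrite /is_edge -andbA; case: ltnP => //= lt_ij.
apply/exists_inP/andP.
  case=> B' /setD1P[_ /imsetP[B BP ->]] /and3P[].
  rewrite !inE => /andP[iB _] /andP[jB lt_jm] /forall_inP tB; split=> //.
  apply/exists_inP; exists B => //; rewrite iB jB; apply/forall_inP => t tB'.
  apply/negP => /andP[lt_it lt_tj]; have := tB t.
  by rewrite !inE tB' lt_it lt_tj (ltn_trans lt_tj lt_jm) => /(_ isT).
case=> /exists_inP[B BP /and3P[iB jB /forall_inP tB]] lt_jm.
exists (B :&: [set j : 'I_n | j < m]).
  apply/setD1P; split; last exact: imset_f.
  by apply/set0Pn; exists j; rewrite !inE jB.
rewrite !inE iB jB lt_jm (ltn_trans lt_ij lt_jm) /=.
by apply/forall_inP => t; rewrite !inE => /andP[/tB].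
Qed.

(** The integer [i] is the largest one of [T i.+1], so it can only be the right end of an edge
    there. *)
Lemma connected_before (i : 'I_n) :
  [exists j, connected (T P i.+1).1 i j] = (mate h i != None).
Proof.
have [edgeE _] := repr i.
apply/existsP/idP => [[j]|].
  rewrite /connected !is_edge_restrict ltnSn andbT edgeE.
  case/orP=> [/andP[/is_edge_lt]|/eqP->//].
  lia.
case e: (mate h i) => [x|//] _.
have lt_x : x < n.
  move: e; rewrite /mate; case ek: (h i).1 => [k|//] [<-].
  have [lt_k _] := v.1 i k (ltn_ord i) ek.
  have [_ s_lt] := opens_spec h i.
  exact: ltn_trans (s_lt _ (mem_nth 0 lt_k)) (ltn_ord i).
exists (Ordinal lt_x); rewrite /connected !is_edge_restrict ltnSn edgeE e.
by rewrite eqxx orbT.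
Qed.

Lemma mate_none i : (mate h i == None) = new h i.
Proof. by rewrite /mate /new; case: (h i).1. Qed.

(** The open integers are the marked integers of [T i], and the marked letters read from the right
    form the stack. The three cases of [stepP] thus match the three branches of [step1]. *)
Lemma step1E (i : 'I_n) :
  step1 P i (word_with_marks h (marks h i) i) =
    Some (word_with_marks h (pruned_marks h i) i.+1).
Proof.
have lt_i := ltn_ord i; have [edgeE _] := repr i.
have [s_sort _ _ s'_bd] := marks_spec h i.
have opensE : opens h i = map val (marked_integers P i).
  apply: (opens_marked_integers partP repr) (ltnW lt_i) => j k lt_j ek.
  by have [] := v.1 j k lt_j ek.
have szE := valid_size_marks v (ltnW lt_i).
have mposE := marked_positions_letters v (ltnW lt_i).
have pos_new p : p \in marked_positions (word_with_marks h (marks h i) i) ->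
    p < i /\ new h p.
  rewrite mem_rev mem_filter mem_iota size_word_with_marks => /andP[+ /= lt_p].
  by rewrite nth_word_with_marks // => /andP[].
have open_lt (j : 'I_n) : val j \in opens h i -> j < i.
  by have [_ s_lt] := opens_spec h i; apply: s_lt.
have uniq_o := opens_uniq h i.
rewrite /step1 connected_before mate_none /mate in edgeE *.
rewrite word_with_marksS /new; move: s'_bd mposE szE pos_new.
set mp := marked_positions _.
case: (stepP v lt_i) edgeE => [s|x s le_x lt_s|x s lt_x lt_s]
  edgeE s'_bd mposE szE pos_new /=.
- rewrite max_letter_word -(top_letter_pmax v) ?(ltnW lt_i) //.
  by case e: (_ \in s) => //; have := s'_bd _ e; rewrite ltnn.
- have x_s : x \notin s by apply/negP => /lt_s; rewrite ltnn.
  rewrite opensE in szE edgeE.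
  case: (marked_integers P i) szE edgeE => // j1 js _ edgeE.
  case: mp mposE pos_new => // p1 ps [ep1 _] /(_ _ (mem_head _ _)) [lt_p1 new_p1].
  rewrite connectedC /connected edgeE /= eqxx.
  by rewrite (letter_word_with_marks _ _ lt_p1) ep1 (set_mark_false lt_p1 new_p1 ep1).
- have top_s : top_letter h i \notin x :: s.
    by apply/negP; rewrite inE => /orP[/eqP|/lt_s]; lia.
  rewrite opensE in szE edgeE uniq_o open_lt.
  case: (marked_integers P i) szE edgeE uniq_o open_lt =>
    [|j1 [|j2 js]] // _ edgeE uniq_o open_lt.
  case: mp mposE pos_new => [|p1 [|p2 ps]] // [ep1 ep2 _] pos_new.
  have [lt_p1 new_p1] := pos_new p1 (mem_head _ _).
  have [|lt_p2 new_p2] := pos_new p2; first by rewrite !inE eqxx orbT.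
  have lt_j1 := open_lt j1 (mem_head _ _).
  (* The mate of [i] is [j2], and [j1] differs from it because the stack of open integers has no
     repetition. *)
  have -> : connected P i j1 = false.
    rewrite connectedC connectedE // edgeE /=; apply: contraTF uniq_o => /eqP[/val_inj->].
    by rewrite /= mem_head.
  rewrite connectedC /connected edgeE /= eqxx.
  by rewrite (letter_word_with_marks _ _ lt_p2) ep2 (set_mark_false lt_p1 new_p1 ep1).
Qed.

Lemma step2E (i : 'I_n) :
  step2 P i (word_with_marks h (pruned_marks h i) i.+1) =
    word_with_marks h (marks h i.+1) i.+1.
Proof.
have [_ markE] := repr i; rewrite /step2 (mem_T2 partP) ltnSn /=.
have -> : [exists k : 'I_n, (i < k) && is_edge P i k] = (h i).2.
  rewrite markE; apply: eq_existsb => k.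
  by apply/andP/idP => [[]//|e]; rewrite e (is_edge_lt e).
have := @valid_marks_gt0 n h v i.+1 _ (ltn_ord i).
rewrite marksS; case: (h i).2 => // /(_ _ (mem_head _ _)) top_gt0.
by rewrite (mark_leftmost_maxE _ v).
Qed.

Lemma bwE m : m <= n -> bw P m = Some (word_with_marks h (marks h m) m).
Proof.
elim: m => [_|m IHm lt_m]; first by rewrite /bw take0.
pose i := Ordinal lt_m; rewrite /bw (take_nth i) ?size_enum_ord // foldl_rcons.
rewrite -/(bw P m) (IHm (ltnW lt_m)) /= -[m]/(val i) nth_ord_enum.
by rewrite step1E /= step2E.
Qed.

Lemma bw_last : bw P n = Some (unmarked (mkseq (next_letter h) n)).
Proof.
rewrite bwE // (valid_marks_last v) /word_with_marks /unmarked -map_comp.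
by congr Some; apply: eq_map => j /=; rewrite andbF.
Qed.

End Run.

(** * Partitions and histories *)

Section EdgesDetermine.

Variable n : nat.
Implicit Types P : {set {set 'I_n}}.

(** Strong induction on [j]: the largest element of its block below [j] is joined to it by an edge,
    which carries over to [P'], and the induction continues from that element. *)
Lemma sub_pblock P P' (i j : 'I_n) :
    partition P [set: 'I_n] -> partition P' [set: 'I_n] ->
    (forall k l, is_edge P k l -> is_edge P' k l) ->
  i <= j -> i \in pblock P j -> i \in pblock P' j.
Proof.
move=> partP partP' sub_e.
have [m] := ubnP j; elim: m => // m IHm in i j *.
rewrite ltnS => le_jm le_ij i_j; case: (eqVneq i j) => [->|ne_ij].
  exact: mem_pblock_id.
have lt_ij : i < j by rewrite ltn_neqAle ne_ij.
have [k /andP[k_j lt_kj] k_max] :=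
  @arg_maxnP _ i [pred k | (k \in pblock P j) && (k < j)] val
    (introT andP (conj i_j lt_ij)).
have le_ik : i <= k by apply: k_max; rewrite /= i_j.
have e_kj : is_edge P k j.
  apply/(is_edgeP partP); split=> // t t_j; apply/negP => /andP[lt_kt lt_tj].
  by have := k_max t; rewrite /= t_j lt_tj leqNgt lt_kt => /(_ isT).
have /(is_edgeP partP')[_ k'_j _] := sub_e _ _ e_kj.
rewrite -(partition_same_pblock partP' k'_j); apply: IHm => //.
  exact: leq_trans lt_kj le_jm.
by rewrite (partition_same_pblock partP k_j).
Qed.

Lemma edges_inj P P' : partition P [set: 'I_n] -> partition P' [set: 'I_n] ->
  (forall i j, is_edge P i j = is_edge P' i j) -> P = P'.
Proof.
move=> partP partP' eq_e.
rewrite -(equivalence_partition_pblock partP) -(equivalence_partition_pblock partP').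
have sub Q Q' : partition Q [set: 'I_n] -> partition Q' [set: 'I_n] ->
    (forall k l, is_edge Q k l -> is_edge Q' k l) ->
    forall x y, y \in pblock Q x -> y \in pblock Q' x.
  move=> partQ partQ' sub_e x y y_x.
  case: (leqP y x) => [le_yx|lt_xy]; first exact: sub_pblock le_yx y_x.
  have x_y : x \in pblock Q y by rewrite (partition_same_pblock partQ y_x) mem_pblock_id.
  have x'_y := sub_pblock partQ partQ' sub_e (ltnW lt_xy) x_y.
  by rewrite (partition_same_pblock partQ' x'_y) mem_pblock_id.
apply: eq_imset => x; apply/setP=> y; rewrite !inE /=.
by apply/idP/idP; apply: sub => // k l; rewrite eq_e.
Qed.

End EdgesDetermine.

Lemma eq_opens h h' i : (forall j, j < i -> h j = h' j) -> opens h i = opens h' i.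
Proof.
elim: i => //= i IHi eq_h; rewrite eq_h // IHi // => j lt_j.
by apply: eq_h; apply: ltnW.
Qed.

Lemma represents_inj n (P P' : {set {set 'I_n}}) h h' :
    partition P [set: 'I_n] -> partition P' [set: 'I_n] ->
    represents P h -> represents P' h' -> (forall i, i < n -> h i = h' i) ->
  P = P'.
Proof.
move=> partP partP' repr repr' eq_h; apply: edges_inj => // i j.
rewrite (repr j).1 (repr' j).1 /mate eq_h // (@eq_opens h h') // => k lt_k.
by apply: eq_h; apply: ltn_trans lt_k _.
Qed.

Lemma nth_gtn_sorted (s : seq nat) k l : sorted gtn s -> k < l -> l < size s ->
  nth 0 s l < nth 0 s k.
Proof.
move=> s_sort lt_kl lt_l.
by apply: (sorted_ltn_nth gtn_trans 0 s_sort); rewrite ?inE // (ltn_trans lt_kl).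
Qed.

(** * The history of a partition, valid when the partition is 2-distant noncrossing *)

Section FromPartition.

Variables (n : nat) (P : {set {set 'I_n}}).
Hypothesis partP : partition P [set: 'I_n].

Definition history_of : history := fun j =>
  if insub j is Some o then
    (omap (fun i : 'I_n => index (val i) (map val (marked_integers P j)))
       [pick i | is_edge P i o],
     [exists k, is_edge P o k])
  else (None, false).

Lemma history_ofE (j : 'I_n) : history_of j =
  (omap (fun i : 'I_n => index (val i) (map val (marked_integers P j)))
     [pick i | is_edge P i j], [exists k, is_edge P j k]).
Proof. by rewrite /history_of valK. Qed.

Lemma edge_marked_integers (i j : 'I_n) : is_edge P i j ->
  val i \in map val (marked_integers P j).
Proof.
move=> e; rewrite (mem_marked_integers partP) (is_edge_lt e) /=.
by apply/existsP; exists j; rewrite leqnn.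
Qed.

Lemma history_of_size (j : 'I_n) (k : nat) : (history_of j).1 = Some k ->
  k < size (map val (marked_integers P j)).
Proof.
rewrite history_ofE /=; case: pickP => //= i e [<-].
by rewrite index_mem edge_marked_integers.
Qed.

Lemma history_of_mate (j : 'I_n) :
    opens history_of j = map val (marked_integers P j) ->
  forall i, is_edge P i j = (mate history_of j == Some (val i)).
Proof.
move=> opensE i; rewrite /mate opensE history_ofE /=.
case: pickP => [i' e|no_e] /=; last exact: no_e.
rewrite nth_index ?edge_marked_integers // (inj_eq Some_inj).
by apply/idP/eqP => [e'|/val_inj<-//]; rewrite (pred_edge_inj partP e e').
Qed.

Lemma history_of_opens j : j <= n ->
  opens history_of j = map val (marked_integers P j).
Proof.
elim: j => [_|j IHj lt_j].
  rewrite /marked_integers; case: (enum _) (mem_enum (T P 0).2) => // x s /(_ x).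
  by rewrite mem_head (mem_T2 partP) ltn0.
have opensE := IHj (ltnW lt_j); pose o := Ordinal lt_j.
apply: (opens_step partP (j := o)) => //.
- exact: history_of_mate.
- by rewrite history_ofE.
- by move=> k /history_of_size; rewrite opensE.
Qed.

Lemma history_of_represents : represents P history_of.
Proof.
move=> j; split; first by apply: history_of_mate; apply: history_of_opens; apply: ltnW.
by rewrite history_ofE.
Qed.

Lemma history_of_valid :
    (forall i1 j1 i2 j2 : 'I_n, is_edge P i1 j1 -> is_edge P i2 j2 ->
       ~ (i1 < i2 /\ i2 < j1 /\ j1 < j2 /\ 2 <= j1 - i2)) ->
  valid n history_of.
Proof.
move=> nc; split; last first.
  rewrite history_of_opens // /marked_integers.
  case: (enum _) (mem_enum (T P n).2) => // x s /(_ x).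
  rewrite mem_head (mem_T2 partP) => /esym/andP[_ /existsP[k /andP[le_nk _]]].
  by have := ltn_ord k; rewrite ltnNge le_nk.
move=> j0 k lt_j; rewrite -[j0]/(val (Ordinal lt_j)); move: (Ordinal lt_j) => j ek.
have opensE := history_of_opens (ltnW (ltn_ord j)).
have lt_k := history_of_size ek; rewrite -opensE in lt_k; split=> //.
have [s_sort _] := opens_spec history_of j.
(* An open integer above the mate [i] of [j] belongs to an edge ending after [j], which crosses the
   edge from [i] to [j]. Noncrossing leaves only [j - 1], so at most one open integer lies above the
   mate. *)
have near l : l < k -> j.-1 <= nth 0 (opens history_of j) l.
  move=> lt_lk; have lt_l := ltn_trans lt_lk lt_k.
  have := mem_nth 0 lt_l; rewrite {2}opensE => /mapP[x x_s ex].
  have := map_f val x_s; rewrite (mem_marked_integers partP).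
  case/andP=> lt_xj /existsP[j2 /andP[le_jj2 e2]].
  have := mem_nth 0 lt_k; rewrite {2}opensE => /mapP[i _ ei].
  have e1 : is_edge P i j.
    by rewrite (history_of_mate opensE) /mate ek /= ei.
  have lt_ix : i < x.
    by rewrite -[nat_of_ord i]/(val i) -ei -[nat_of_ord x]/(val x) -ex nth_gtn_sorted.
  have ne_j2 : j2 != j by apply/eqP => ej; move: lt_ix; rewrite ej in e2;
    rewrite (pred_edge_inj partP e1 e2) ltnn.
  have lt_jj2 : j < j2 by rewrite ltn_neqAle eq_sym le_jj2 andbT.
  rewrite ex; case: (ltnP x j.-1) => // lt_x.
  by case: (nc _ _ _ _ e1 e2); split=> //; split=> //; split=> //; lia.
have lt_nth l : l < k -> nth 0 (opens history_of j) l < j.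
  move=> lt_lk; have [_ s_lt] := opens_spec history_of j.
  by apply: s_lt; apply: mem_nth; apply: ltn_trans lt_k.
case: k ek lt_k near lt_nth => [|[|k]] ek lt_k near lt_nth; first by left.
- right; split=> //; rewrite top_letter_marked.
  have := near 0 isT; have := lt_nth 0 isT => lt0 ge0.
  have j_gt0 : 0 < j by lia.
  rewrite j_gt0 /=.
  have lt_j' : j.-1 < n by rewrite (leq_ltn_trans (leq_pred _)).
  rewrite -[j.-1]/(val (Ordinal lt_j')) history_ofE /=.
  have := mem_nth 0 (ltnW lt_k); have -> : nth 0 (opens history_of j) 0 = j.-1 by lia.
  rewrite opensE -[j.-1]/(val (Ordinal lt_j')) (mem_marked_integers partP).
  by case/andP=> _ /existsP[l /andP[_ e]]; apply/existsP; exists l.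
- have := near 1 isT; have := lt_nth 0 isT.
  by have := nth_gtn_sorted s_sort (ltnSn 0) (leq_trans _ lt_k) => /(_ isT); lia.
Qed.

End FromPartition.

(* [label p j] follows the predecessor function [p] down to the smallest
   element of the block of [j]; [j] is enough fuel since [p] decreases. *)
Fixpoint follow (p : nat -> option nat) d j :=
  if d is d'.+1 then (if p j is Some i then follow p d' i else j) else j.

Definition label p j := follow p j j.

(** * Chains of a decreasing and injective predecessor function *)

Section Labels.

Variable p : nat -> option nat.
Hypothesis p_lt : forall i j, p j = Some i -> i < j.
Hypothesis p_inj : forall i j k, p j = Some i -> p k = Some i -> j = k.

Lemma follow_fuel d j : j <= d -> follow p d j = label p j.
Proof.
have [m] := ubnP j; elim: m => // m IHm in d j *; rewrite ltnS => le_jm le_jd.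
rewrite /label; case: j le_jm le_jd => [|j] le_jm le_jd.
  by case: d le_jd => //= d _; case e: (p 0) => [i|] //; have := p_lt e.
case: d le_jd => //= d le_jd; case e: (p j.+1) => [i|] //.
by have := p_lt e; rewrite ltnS => le_ij; rewrite !IHm //; lia.
Qed.

Lemma labelE j : label p j = if p j is Some i then label p i else j.
Proof.
rewrite {1}/label; case: j => [|j] /=.
  by case e: (p 0) => [i|] //; have := p_lt e.
by case e: (p j.+1) => [i|] //; rewrite follow_fuel //; have := p_lt e; rewrite ltnS.
Qed.

Lemma label_leq j : label p j <= j.
Proof.
elim/ltn_ind: j => j IHj; rewrite labelE; case e: (p j) => [i|] //.
by have lt_ij := p_lt e; apply: leq_trans (IHj i lt_ij) (ltnW lt_ij).
Qed.

(** Strong induction on [j], comparing its predecessor [i'] with [i]. If [i < i'], descend to [i'];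
    if [i' < i], then [i] lies between [i'] and [j], with roles exchanged; equality contradicts
    injectivity. *)
Lemma label_between i j k : p k = Some i -> i < j -> j < k -> label p j <> label p i.
Proof.
elim/ltn_ind: j i k => j IHj i k e_k lt_ij lt_jk; rewrite labelE.
case e_j: (p j) => [i'|]; last by have := label_leq i; lia.
have lt_i'j := p_lt e_j.
case: (ltngtP i i') => [lt_ii'|lt_i'i|eq_i].
- by apply: (IHj i' lt_i'j _ k) => //; lia.
- by move=> e; apply: (IHj i lt_ij i' j).
- by move: e_k; rewrite eq_i => /p_inj/(_ e_j); lia.
Qed.

Lemma label_edge i j : i < j ->
  (label p i = label p j /\ (forall t, i < t -> t < j -> label p t <> label p j)) <->
  p j = Some i.
Proof.
move=> lt_ij; split=> [[eq_l no_t]|e]; last first.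
  by split=> [|t lt_it lt_tj]; rewrite [label p j]labelE e //; apply: label_between e _ _.
case e: (p j) => [i'|]; last first.
  by have := label_leq i; rewrite eq_l labelE e; lia.
have lt_i'j := p_lt e; have eq_l' : label p i' = label p j by rewrite [RHS]labelE e.
case: (ltngtP i i') => [lt_ii'|lt_i'i|-> //].
- by case: (no_t i').
- by case: (label_between e lt_i'i lt_ij); rewrite eq_l' eq_l.
Qed.

End Labels.

(** * The 2-distant noncrossing partition of a valid history *)

Section ToPartition.

Variables (n : nat) (h : history).
Hypothesis v : valid n h.

(** Backward induction from [n], where validity leaves nothing open: every open integer must be
    closed later. *)
Lemma opens_mate i x : i <= n ->
  reflect (x < i /\ exists2 j, i <= j < n & mate h j = Some x) (x \in opens h i).
Proof.
move=> le_i; rewrite -(subKn le_i); move: (n - i) (leq_subr i n) => d.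
elim: d => [|d IHd] le_d.
  rewrite subn0 v.2; apply: (iffP idP) => // -[_ [j]]; lia.
have {}IHd := IHd (ltnW le_d); move: IHd.
have -> : n - d = (n - d.+1).+1 by lia.
have lt_i' : n - d.+1 < n by lia.
move: (n - d.+1) lt_i' => {le_i le_d d} {}i lt_i IHd.
have [s_sort s_lt] := opens_spec h i.
have memS := @mem_opensS h i x (fun k ek => (v.1 i k lt_i ek).1).
apply: (iffP idP) => [xs|[lt_x [j j_bd ej]]].
  split; first exact: s_lt.
  case: (eqVneq (mate h i) (Some x)) => [ei|ne]; first by exists i => //; lia.
  have /IHd[_ [j j_bd ej]] : x \in opens h i.+1 by rewrite memS xs ne orbT.
  by exists j => //; lia.
case: (eqVneq i j) => [eij|ne_ij].
  move: ej; rewrite -eij /mate; case ek: (h i).1 => [k|] //= [<-].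
  by apply: mem_nth; have [] := v.1 i k lt_i ek.
have : x \in opens h i.+1 by apply/IHd; split; [lia | exists j => //; lia].
by rewrite memS (ltn_eqF lt_x) /= => /andP[].
Qed.

(** Validity says nothing about [h] from [n] on, so predecessors are cut off there to be decreasing
    and injective everywhere. *)
Definition mate_in j := if j < n then mate h j else None.

Lemma mate_mem j x : j < n -> mate h j = Some x -> x \in opens h j.
Proof.
move=> lt_j; rewrite /mate; case ek: (h j).1 => [k|] //= [<-].
by apply: mem_nth; have [] := v.1 j k lt_j ek.
Qed.

Lemma mate_in_lt i j : mate_in j = Some i -> i < j.
Proof.
rewrite /mate_in; case: ltnP => // lt_j /(mate_mem lt_j).
by have [_ s_lt] := opens_spec h j; apply: s_lt.
Qed.

(** Only the current integer is ever pushed, so a closed integer never reopens; this makes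
    predecessors injective. *)
Lemma mate_gone j x : j < n -> mate h j = Some x -> forall l, j < l -> l <= n ->
  x \notin opens h l.
Proof.
move=> lt_j ej; elim=> // l IHl; rewrite ltnS => le_jl lt_l.
rewrite (@mem_opensS h l x (fun k ek => (v.1 l k lt_l ek).1)).
have lt_xj : x < j by apply: mate_in_lt; rewrite /mate_in lt_j.
rewrite ltn_eqF ?(leq_trans lt_xj) //=.
move: le_jl; rewrite leq_eqVlt => /orP[/eqP<-|lt_jl]; first by rewrite ej eqxx andbF.
by rewrite (negPf (IHl lt_jl (ltnW lt_l))).
Qed.

Lemma mate_in_inj i j k : mate_in j = Some i -> mate_in k = Some i -> j = k.
Proof.
rewrite /mate_in; case: ltnP => // lt_j ej; case: ltnP => // lt_k ek.
case: (ltngtP j k) => // [lt_jk|lt_kj].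
- by have := mate_gone lt_j ej lt_jk (ltnW lt_k); rewrite (mate_mem lt_k ek).
- by have := mate_gone lt_k ek lt_kj (ltnW lt_j); rewrite (mate_mem lt_j ej).
Qed.

Definition partition_of : {set {set 'I_n}} :=
  preim_partition (fun i : 'I_n => label mate_in i) [set: 'I_n].

Lemma partition_ofP : partition partition_of [set: 'I_n].
Proof. exact: preim_partitionP. Qed.

Lemma mem_partition_of (i j : 'I_n) :
  (i \in pblock partition_of j) = (label mate_in j == label mate_in i).
Proof. by rewrite pblock_equivalence_partition // => ? ? ? _ _ _; split=> // /eqP->. Qed.

Lemma partition_of_edge (i j : 'I_n) :
  is_edge partition_of i j = (mate h j == Some (val i)).
Proof.
have -> : mate h j = mate_in j by rewrite /mate_in ltn_ord.
apply/(is_edgeP partition_ofP)/eqP => [[lt_ij i_j t_j]|e].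
  apply/(label_edge mate_in_lt mate_in_inj lt_ij).
  move: i_j; rewrite mem_partition_of => /eqP eq_l; split=> // t lt_it lt_tj et.
  have lt_tn := ltn_trans lt_tj (ltn_ord j).
  have := t_j (Ordinal lt_tn); rewrite mem_partition_of /= et eqxx lt_it lt_tj.
  by move=> /(_ isT).
have lt_ij := mate_in_lt e.
have [eq_l no_t] := (label_edge mate_in_lt mate_in_inj lt_ij).2 e.
split=> // [|t]; rewrite mem_partition_of; first by rewrite eq_l.
by move=> /eqP et; apply/negP => /andP[lt_it /(no_t _ lt_it)]; rewrite et.
Qed.

Lemma partition_of_represents : represents partition_of h.
Proof.
move=> j; split=> [i|]; first exact: partition_of_edge.
have -> : (h j).2 = (val j \in opens h j.+1).
  rewrite (@mem_opensS h j j (fun k ek => (v.1 j k (ltn_ord j) ek).1)) eqxx /=.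
  have [_ s_lt] := opens_spec h j.
  by case e: (_ \in _); rewrite ?orbF //; have := s_lt _ e; rewrite ltnn.
apply/(opens_mate _ (ltn_ord j))/existsP => [[_ [k /andP[lt_jk lt_k] ek]]|[k]].
  by exists (Ordinal lt_k); rewrite partition_of_edge ek.
rewrite partition_of_edge => /eqP ek; split=> //; exists (val k) => //.
rewrite ltn_ord andbT; apply: mate_in_lt; by rewrite /mate_in ltn_ord.
Qed.

(** In a forbidden crossing, [i2] is open at [j1] and above [i1], so the index used at [j1] is 1 and
    [i2] is the largest open integer. But then the integer just before [j1] is open too, and it
    exceeds [i2] by the distance condition. *)
Lemma partition_of_NC2 : NC2 partition_of.
Proof.
split=> [|i1 j1 i2 j2]; first exact: partition_ofP.
rewrite !partition_of_edge => /eqP e1 /eqP e2 [lt_i [lt_ij [lt_j dist]]].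
have lt_j1 := ltn_ord j1.
have i2_open : val i2 \in opens h j1.
  apply/(opens_mate _ (ltnW lt_j1)); split=> //; exists (val j2) => //.
  by rewrite ltn_ord ltnW.
have [s_sort s_lt] := opens_spec h j1.
move: e1; rewrite /mate; case ek: (h j1).1 => [k|] //= [e1].
have [lt_k k_spec] := v.1 j1 k lt_j1 ek.
have lt_i2k : index (val i2) (opens h j1) < k.
  rewrite ltnNge; apply/negP; rewrite leq_eqVlt => /orP[/eqP ei|lt_ki].
    by move: lt_i; rewrite -e1 ei nth_index // ltnn.
  have := nth_gtn_sorted s_sort lt_ki; rewrite index_mem => /(_ i2_open).
  by rewrite nth_index // e1; move: lt_i => /=; lia.
case: k_spec => [k0|[k1]]; first by move: lt_i2k; rewrite k0.
rewrite top_letter_marked => /andP[j1_gt0 mk].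
have j1'_open : j1.-1 \in opens h j1.
  rewrite -{2}(prednK j1_gt0) (@mem_opensS h j1.-1) ?eqxx ?mk //.
  by move=> l el; apply: (v.1 _ l _ el).1; lia.
move: lt_i2k; rewrite k1 ltnS leqn0 => /eqP i2_0.
have i2E : nth 0 (opens h j1) 0 = val i2 by rewrite -i2_0 nth_index.
case: (posnP (index j1.-1 (opens h j1))) => [idx0|idx_gt0].
  by have := nth_index 0 j1'_open; rewrite idx0 i2E /=; lia.
have := nth_gtn_sorted s_sort idx_gt0; rewrite index_mem => /(_ j1'_open).
by rewrite nth_index // i2E /=; lia.
Qed.

End ToPartition.

Theorem theorem3p2 (n : nat) :
  (forall P : {set {set 'I_n}}, NC2 P ->
     exists2 Q : {set {set 'I_n}},
       P12312 Q & bw P n = Some (unmarked (canonical_word Q))) /\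
  (forall P P' : {set {set 'I_n}}, NC2 P -> NC2 P' ->
     bw P n = bw P' n -> P = P') /\
  (forall Q : {set {set 'I_n}}, P12312 Q ->
     exists2 P : {set {set 'I_n}},
       NC2 P & bw P n = Some (unmarked (canonical_word Q))).
Proof.
have unmarked_inj u w : unmarked u = unmarked w -> u = w.
  by apply: inj_map => a b [].
split; [|split].
- move=> P [partP nc]; have v := history_of_valid partP nc.
  have a_rgf := next_letter_rgf v.
  have [Q partQ wQ] := rgf_canonical_word a_rgf.
  exists Q; last by rewrite (bw_last partP v (history_of_represents partP)) wQ.
  split=> //; rewrite wQ => /(contains_12312 a_rgf)[i [j [lt_ij lt_j lt_a]]].
  rewrite -(top_letter_pmax v); last exact: ltnW (ltn_trans lt_ij lt_j).
  exact: next_letter_avoids v lt_ij lt_j lt_a.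
- move=> P P' [partP nc] [partP' nc'].
  have v := history_of_valid partP nc; have v' := history_of_valid partP' nc'.
  have r := history_of_represents partP; have r' := history_of_represents partP'.
  rewrite (bw_last partP v r) (bw_last partP' v' r') => -[/unmarked_inj eq_w].
  (* Equal words give equal histories below [n], and these determine all edges, hence the
     partition. *)
  apply: (represents_inj partP partP' r r'); apply: (valid_inj v v') => i lt_i.
  by have := congr1 (nth 0 ^~ i) eq_w; rewrite /= !nth_mkseq.
- move=> Q [partQ avoidQ]; have a_rgf := canonical_word_rgf partQ.
  have wQ : mkseq (nth 0 (canonical_word Q)) n = canonical_word Q.
    by rewrite -{2}(size_canonical_word Q) mkseq_nth.
  have [i j lt_ij lt_j lt_a lt_m|h v eq_a] := rgf_history a_rgf.
    by apply: avoidQ; rewrite -wQ; apply/(contains_12312 a_rgf); exists i, j.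
  exists (partition_of n h); first exact: partition_of_NC2.
  rewrite (bw_last (partition_ofP n h) v (partition_of_represents v)) -wQ.
  congr (Some (unmarked _)); apply: (@eq_from_nth _ 0); rewrite !size_mkseq // => i lt_i.
  by rewrite !nth_mkseq // eq_a.
Qed.
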